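(* Let $G$ be a finite group with $|G|\ge 2$ and let $\mu$ be a probability measure on $G$ such that the transition matrix $P_\mu(x,y)=\mu(x^{-1}\cdot y)$, $x,y\in G$, is irreducible and aperiodic. Then there exists a constant $C=C(G,\mu)>0$ such that for every $\alpha\in[0,1)$ there exists a constant $\rho=\rho(G,\mu,\alpha)\in(0,1)$ such that, if $S=(S_n)_{n\in\mathbb{N}}$ is the step-reinforced random walk (SRRW) on $G$ with step distribution $\mu$ and reinforcement parameter $\alpha$, then for every $n\ge 1$, $$\|\mathbb{P}(S_n=\cdot)-U\|_{\mathrm{TV}}\le C\rho^{(1-\alpha)n},$$ where $U$ is the uniform measure on $G$.
   Context: SRRW: Let $(G,\cdot)$ be a discrete group with $|G|\ge2$ and identity $e_G$, $\mu$ a probability measure on $G$, and $\alpha\in[0,1)$. Let $(\xi_n)_{n\ge2}$ be i.i.d. Bernoulli random variables with $\mathbb{P}(\xi_n=1)=\alpha$, and let $(u_n)_{n\ge2}$ be independent with $u_n$ uniform on $\{1,\dots,n-1\}$; these two sequences and all fresh samples from $\mu$ below are independent. Set $S_0=e_G$; sample $X_1$ from $\mu$ and set $S_1=X_1$. For $n>1$: if $\xi_n=1$ set $X_n=X_{u_n}$; if $\xi_n=0$ sample $X_n$ afresh from $\mu$; put $S_n=S_{n-1}\cdot X_n$. The process $(S_n)$ is the SRRW on $G$ (started at $e_G$) with step distribution $\mu$ and reinforcement parameter $\alpha$. Total variation distance: $\|\nu_1-\nu_2\|_{\mathrm{TV}}=\frac12\sum_{g\in G}|\nu_1(g)-\nu_2(g)|$.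 *)

(* Defs.v *)
From HB Require Import structures.
From mathcomp Require Import all_boot all_order all_algebra all_fingroup finmap.
From mathcomp Require Import all_classical all_reals all_analysis.
Set Implicit Arguments.
Unset Strict Implicit.
Unset Printing Implicit Defensive.
Import Order.TTheory GRing.Theory Num.Theory.
Local Open Scope classical_set_scope.
Local Open Scope ring_scope.

Definition is_prob_mass (R : realType) (T : finType) (mu : T -> R) : Prop :=
  (forall x, 0 <= mu x) /\ \sum_x mu x = 1.

Definition tv_dist (R : realType) (T : finType) (nu1 nu2 : T -> R) : R :=
  2^-1 * \sum_x `|nu1 x - nu2 x|.

Definition uniform_mass (R : realType) (T : finType) (_ : T) : R := #|T|%:R^-1.

(* The states of the chain are the indices of the matrix; those of [walk_mx]
   enumerate the group. *)
Definition walk_mx (R : realType) (gT : finGroupType) (mu : gT -> R) :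
    'M[R]_#|gT| :=
  \matrix_(i, j) mu ((enum_val i)^-1 * enum_val j)%g.

Definition irreducible_chain (R : realType) (m : nat) (A : 'M[R]_m) : Prop :=
  forall i j, exists k : nat, 0 < (A ^+ k) i j.

(* gcd of a possibly infinite set of natural numbers *)
Definition is_gcd (D : set nat) (g : nat) : Prop :=
  (forall k, D k -> (g %| k)%N) /\
  (forall d, (forall k, D k -> (d %| k)%N) -> (d %| g)%N).

Definition aperiodic_chain (R : realType) (m : nat) (A : 'M[R]_m) : Prop :=
  forall i, is_gcd [set k | (0 < k)%N /\ 0 < (A ^+ k) i i] 1.

(* The family [F i], [i] in [D], of classes of events is independent. *)
Definition independent_classes (d : measure_display) (T : measurableType d)
    (R : realType) (P : probability T R) (I : choiceType) (D : set I)
    (F : I -> set (set T)) : Prop :=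
  forall (J : {fset I}) (E : I -> set T),
    (forall i, i \in J -> D i /\ F i (E i)) ->
    P (\bigcap_(i in [set` J]) E i) = (\prod_(i <- J) P (E i))%E.

(* The sigma-algebra generated by a variable with values in a countable set [A]
   carrying its discrete sigma-algebra. *)
Definition rv_events (T A : Type) (X : T -> A) : set (set T) :=
  preimage_set_system [set: T] X [set: set A].

Definition discrete_rv (d : measure_display) (T : measurableType d) (A : Type)
    (X : T -> A) : Prop :=
  rv_events X `<=` measurable.

(* [xi n] and [u n] are only meaningful for [n >= 2], the fresh sample [Y n]
   for [n >= 1]; values at other indices are unconstrained. *)
Definition driver_index (i : nat + nat + nat) : Prop :=
  match i with
  | inl (inl n) => (2 <= n)%N
  | inl (inr n) => (2 <= n)%N
  | inr n => (1 <= n)%N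
  end.

Definition driver_events (T A : Type) (xi : nat -> T -> bool)
    (u : nat -> T -> nat) (Y : nat -> T -> A) (i : nat + nat + nat) :
    set (set T) :=
  match i with
  | inl (inl n) => rv_events (xi n)
  | inl (inr n) => rv_events (u n)
  | inr n => rv_events (Y n)
  end.

Record srrw_driver (d : measure_display) (T : measurableType d) (R : realType)
    (P : probability T R) (A : Type) (mu : A -> R) (alpha : R)
    (xi : nat -> T -> bool) (u : nat -> T -> nat) (Y : nat -> T -> A) : Prop :=
  SrrwDriver {
    xi_rv : forall n, (2 <= n)%N -> discrete_rv (xi n) ;
    u_rv : forall n, (2 <= n)%N -> discrete_rv (u n) ;
    Y_rv : forall n, (1 <= n)%N -> discrete_rv (Y n) ;
    xi_law : forall n, (2 <= n)%N ->
      P (xi n @^-1` [set true]) = alpha%:E ;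
    u_range : forall n w, (2 <= n)%N -> (1 <= u n w <= n.-1)%N ;
    u_law : forall n k, (2 <= n)%N -> (1 <= k <= n.-1)%N ->
      P (u n @^-1` [set k]) = (n.-1%:R^-1)%:E ;
    Y_law : forall n g, (1 <= n)%N ->
      P (Y n @^-1` [set g]) = (mu g)%:E ;
    driver_indep : independent_classes P driver_index (driver_events xi u Y)
  }.

(* [X 0] is irrelevant. *)
Definition srrw (d : measure_display) (T : measurableType d) (R : realType)
    (P : probability T R) (gT : finGroupType) (mu : gT -> R) (alpha : R)
    (S : nat -> T -> gT) : Prop :=
  exists (xi : nat -> T -> bool) (u : nat -> T -> nat) (Y X : nat -> T -> gT),
    [/\ srrw_driver P mu alpha xi u Y,
        forall w, X 1%N w = Y 1%N w,
        forall n w, (1 < n)%N -> X n w = if xi n w then X (u n w) w else Y n w,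
        forall w, S 0%N w = 1%g &
        forall n w, (1 <= n)%N -> S n w = (S n.-1 w * X n w)%g].

Definition rv_mass (d : measure_display) (T : measurableType d) (R : realType)
    (P : probability T R) (A : Type) (Z : T -> A) (a : A) : R :=
  fine (P (Z @^-1` [set a])).

(* Main.v *)
Require Import Defs.
From HB Require Import structures.
From mathcomp Require Import all_boot all_order all_algebra all_fingroup finmap.
From mathcomp Require Import all_classical all_reals all_analysis.
From mathcomp Require Import zify ring lra.
Set Implicit Arguments.
Unset Strict Implicit.
Unset Printing Implicit Defensive.
Import Order.TTheory GRing.Theory Num.Theory.
Local Open Scope classical_set_scope.
Local Open Scope ring_scope.

(** Copied steps carry no new randomness, but a run of consecutive steps that
    are fresh and never copied later behaves like the ordinary walk, and linearly
    many such runs occur, except with exponentially small probability.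

    Condition on the genealogy, which tells for every step whether it is fresh
    or else which step it copies. The walk is then a product of samples of [mu],
    each read at the steps descending from it. Choose [m] such that the [m]-th
    power of the walk matrix has positive entries ([primitive_chain]); this power
    contracts by some [theta < 1] the l1 norm of vectors of total mass zero
    ([walk_block_contracts]). Cut the last [K * m] of the [n] steps, the window,
    into [K] blocks of [m] steps, and call a block good if its steps are all
    fresh and never copied. The samples of the good blocks are read nowhere else,
    so after freezing all other samples the law of the walk is a product of
    stochastic matrices in which each good block contributes a factor
    [walk_mx mu ^+ m] ([law_mx_frozen]). Given the genealogy, the distance to
    uniformity is thus at most [theta ^+ (number of good blocks)]
    ([law_mx_contracts]); as contraction factors average under mixtures, it
    remains to bound the mean of this quantity.

    Whether a block is good depends on the future, but a fresh block of the
    window is good unless one of its steps is copied, which takes a step with a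
    late source, that is a source in the window ([fresh_le_good_late]). Hence
    the quantity is at most
    [theta ^+ (number of fresh blocks) / theta ^+ (number of late sources)],
    a product of independent factors, one per block ([sum_prod_blocks]). A block
    is fresh with probability [(1 - alpha) ^+ m], and a source is late with
    probability at most [K * m / (n - K * m)], which is small if the window is a
    small fraction of the [n] steps. For a fraction depending only on [m],
    [theta] and [alpha], each factor has mean at most
    [1 - (1 - alpha) ^+ m * (1 - theta) / 2] ([mean_block_factor]). Since [K] is proportional to
    [n], this is exponential decay; and since that bound is at least 1/2, rounding
    [K] costs at most a factor 2, the constant of the theorem. *)

(** * Primitivity of an irreducible aperiodic chain *)

(** The least positive gap between two elements of [D] divides every element
    of [D], so it is 1. From [b] and [b + 1] in [D] one gets every integer
    [k >= b * b]: its remainder modulo [b] is at most its quotient, and counts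
    the copies of [b + 1] to use. *)
Lemma additive_eventually_full (D : set nat) :
  D 0%N -> (forall k l, D k -> D l -> D (k + l)%N) ->
  (forall d, (forall k, D k -> (d %| k)%N) -> (d %| 1)%N) ->
  exists N, forall k, (N <= k)%N -> D k.
Proof.
move=> D0 DD gcdD.
have DM k q : D k -> D (q * k)%N.
  by move=> Dk; elim: q => [|q IHq]; rewrite ?mulSn //; apply: DD.
(* [b = 0] covers the positive elements of [D] themselves. *)
pose gap d := `[< (0 < d)%N /\ exists2 b, D b & D (b + d)%N >].
have [d /asboolP[d_gt0 [b Db Dbd]] d_min] : {d | gap d & forall e, gap e -> (d <= e)%N}.
  have ex_gap : exists d, gap d.
    apply: contrapT => no_gap.
    suff : (0 %| 1)%N by [].
    apply: gcdD => -[|k] // Dk; case: no_gap; exists k.+1.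
    by apply/asboolP; split=> //; exists 0%N.
  by case: (ex_minnP ex_gap) => d ? ?; exists d.
have d1 : d = 1%N.
  apply/eqP; rewrite -dvdn1; apply: gcdD => k Dk.
  rewrite /dvdn eqn0Ngt; apply/negP => r_gt0.
  have /d_min : gap (k %% d)%N.
    apply/asboolP; split=> //; exists ((k %/ d) * (b + d))%N; first exact: DM.
    rewrite (_ : _ + _ = (k %/ d) * b + k)%N; first exact/DD/Dk/DM.
    by rewrite mulnDr -addnA -divn_eq.
  by rewrite leqNgt ltn_pmod.
subst d; exists (b * b)%N => k le_k; have [b0|b_gt0] := posnP b.
  by rewrite -[k]muln1; apply: DM; move: Dbd; rewrite b0.
have le_mod : (k %% b <= k %/ b)%N.
  by apply: (@leq_trans b); [exact/ltnW/ltn_pmod | rewrite leq_divRL].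
rewrite (_ : k = (k %/ b - k %% b) * b + k %% b * (b + 1))%N.
  by apply: DD; apply: DM.
by rewrite mulnDr muln1 addnA -mulnDl subnK // -divn_eq.
Qed.

Section NonnegativeMatrices.
Variables (R : realType) (p : nat).
Implicit Types A B : 'M[R]_p.

Lemma mulmx_gt0 A B i j k :
  (forall i j, 0 <= A i j) -> (forall i j, 0 <= B i j) ->
  0 < A i j -> 0 < B j k -> 0 < (A * B) i k.
Proof.
move=> A0 B0 Aij Bjk; rewrite mxE (bigD1 j) //= ltr_pwDl ?mulr_gt0 //.
by apply: sumr_ge0 => l _; rewrite mulr_ge0.
Qed.

Lemma expmx_ge0 A k : (forall i j, 0 <= A i j) -> forall i j, 0 <= (A ^+ k) i j.
Proof.
move=> A0; elim: k => [|k IHk] i j; first by rewrite expr0 mxE ler0n.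
by rewrite exprS mxE sumr_ge0 // => l _; rewrite mulr_ge0.
Qed.

(** The return times of each state are closed under addition, so they contain
    all large integers; waiting at the starting state turns a path of given
    length into one of any prescribed large length. *)
Lemma primitive_chain A :
  (forall i j, 0 <= A i j) -> irreducible_chain A -> aperiodic_chain A ->
  exists2 k, (0 < k)%N & forall i j, 0 < (A ^+ k) i j.
Proof.
move=> A0 irrA aperA.
have Ak0 k := @expmx_ge0 A k A0.
have /choice[N N_return] i :
    exists N, forall k, (N <= k)%N -> 0 < (A ^+ k) i i.
  apply: (@additive_eventually_full [set k | 0 < (A ^+ k) i i]) => /=.
  - by rewrite expr0 mxE eqxx.
  - by move=> k l Ak Al; rewrite exprD; apply: mulmx_gt0 Ak Al.
  - by move=> d d_dvd; apply: (aperA i).2 => k /= [_ /d_dvd].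
have /choice[l A_path] (ij : 'I_p * 'I_p) : exists k, 0 < (A ^+ k) ij.1 ij.2.
  exact: irrA.
exists (\max_i N i + \max_ij l ij).+1 => // i j.
have le_l := @leq_bigmax _ l (i, j).
rewrite -(subnK (leqW (leq_trans le_l (leq_addl (\max_i N i) _)))) exprD.
apply: mulmx_gt0 (A_path (i, j)) => //=; apply: N_return.
by rewrite -addSn -addnBA // (leq_trans (@leq_bigmax _ N i)) // ltnW // ltn_addr.
Qed.

Lemma prod_scalemx (I : Type) (s : seq I) (P : pred I) (c : I -> R)
    (F : I -> 'M[R]_p) :
  \prod_(i <- s | P i) (c i *: F i) =
  (\prod_(i <- s | P i) c i) *: \prod_(i <- s | P i) F i.
Proof.
elim/big_rec3: _ => [|i A B d _ ->]; first by rewrite scale1r.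
by rewrite -[LHS]/(_ *m _) -scalemxAl -scalemxAr scalerA.
Qed.

(** * Contraction of the l1 norm by stochastic matrices *)

Definition l1norm (v : 'rV[R]_p) : R := \sum_j `|v 0 j|.

Definition stochastic A :=
  (forall i j, 0 <= A i j) /\ (forall i, \sum_j A i j = 1).

(** Contraction on vectors of total mass zero, the differences of two
    probability vectors. Preservation of the zero mass is part of the notion so
    that contractions compose. *)
Definition contracts (r : R) A :=
  forall v : 'rV[R]_p, \sum_j v 0 j = 0 ->
    \sum_j (v *m A) 0 j = 0 /\ l1norm (v *m A) <= r * l1norm v.

Lemma l1norm_ge0 v : 0 <= l1norm v.
Proof. exact: sumr_ge0. Qed.

(** On a vector of total mass zero, subtracting the constant [eps] from every
    entry of the matrix changes nothing, and what remains of each row has mass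
    [1 - p * eps]. *)
Lemma stochastic_contracts (eps : R) A :
  stochastic A -> (forall i j, eps <= A i j) -> contracts (1 - p%:R * eps) A.
Proof.
move=> [A0 A1] le_eps v v0.
have vA j : (v *m A) 0 j = \sum_i v 0 i * (A i j - eps).
  rewrite mxE; under [RHS]eq_bigr do rewrite mulrBr.
  by rewrite sumrB -mulr_suml v0 mul0r subr0.
split.
  under eq_bigr do rewrite mxE; rewrite exchange_big /=.
  by under eq_bigr do rewrite -mulr_sumr A1 mulr1.
apply: (@le_trans _ _ (\sum_j \sum_i `|v 0 i| * (A i j - eps))).
  apply: ler_sum => j _; rewrite vA (le_trans (ler_norm_sum _ _ _)) //.
  by apply: ler_sum => i _; rewrite normrM (ger0_norm (_ : 0 <= A i j - _)) ?subr_ge0.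
rewrite exchange_big /= /l1norm mulr_sumr.
apply: ler_sum => i _; rewrite -mulr_sumr sumrB A1 sumr_const card_ord.
by rewrite mulrC mulr_natl.
Qed.

Lemma stochasticX A k : stochastic A -> stochastic (A ^+ k).
Proof.
move=> [A0 A1]; split; first exact: expmx_ge0.
elim: k => [|k IHk] i.
  rewrite expr0 (bigD1 i) //= !mxE eqxx big1 ?addr0 // => j /negPf jP.
  by rewrite mxE eq_sym jP.
rewrite exprS; under eq_bigr do rewrite mxE; rewrite exchange_big /=.
by under eq_bigr do rewrite -mulr_sumr IHk mulr1.
Qed.

Lemma stochastic_contracts1 A : stochastic A -> contracts 1 A.
Proof.
move=> stA; rewrite -[1]subr0 -(mulr0 p%:R).
by apply: stochastic_contracts => //; case: stA.
Qed.

Lemma contracts_le r s A : r <= s -> contracts r A -> contracts s A.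
Proof.
move=> le_rs cA v /cA[-> vA]; split=> //; apply: le_trans vA _.
by rewrite ler_wpM2r ?l1norm_ge0.
Qed.

Lemma contracts_mul r s A B :
  0 <= s -> contracts r A -> contracts s B -> contracts (r * s) (A * B).
Proof.
move=> s0 cA cB v /cA[vA0 vA]; have [vB0 vB] := cB _ vA0.
rewrite -[A * B]/(A *m B) mulmxA; split=> //; apply: le_trans vB _.
by rewrite (mulrC r) -mulrA ler_wpM2l.
Qed.

Lemma contracts1 : contracts 1 1.
Proof. by move=> v v0; rewrite mulmx1 mul1r. Qed.

Lemma contracts_prod1 (I : Type) (s : seq I) (P : pred I) (F : I -> 'M[R]_p) :
  (forall i, contracts 1 (F i)) -> contracts 1 (\prod_(i <- s | P i) F i).
Proof.
move=> cF; apply: big_ind => //; first exact: contracts1.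
by move=> A B cA cB; rewrite -[1]mulr1; apply: contracts_mul.
Qed.

(** Contraction factors average under mixtures: this turns a bound that holds
    conditionally on some randomness into a bound on the mean. *)
Lemma contracts_sum (I : finType) (c r : I -> R) (F : I -> 'M[R]_p) :
  (forall i, 0 <= c i) -> (forall i, c i != 0 -> contracts (r i) (F i)) ->
  contracts (\sum_i c i * r i) (\sum_i c i *: F i).
Proof.
move=> c0 cF v v0.
have vF j : (v *m (\sum_i c i *: F i)) 0 j = \sum_i c i * (v *m F i) 0 j.
  rewrite mulmx_sumr summxE; apply: eq_bigr => i _.
  by rewrite -scalemxAr mxE.
split.
  under eq_bigr do rewrite vF; rewrite exchange_big /= big1 // => i _.
  rewrite -mulr_sumr; have [->|ci] := eqVneq (c i) 0; first by rewrite mul0r.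
  by rewrite (cF i ci v v0).1 mulr0.
rewrite mulr_suml; apply: (@le_trans _ _ (\sum_j \sum_i c i * `|(v *m F i) 0 j|)).
  apply: ler_sum => j _; rewrite vF (le_trans (ler_norm_sum _ _ _)) //.
  by apply: ler_sum => i _; rewrite normrM ger0_norm.
rewrite exchange_big /=; apply: ler_sum => i _; rewrite -mulr_sumr -mulrA.
have [->|ci] := eqVneq (c i) 0; first by rewrite !mul0r.
by rewrite ler_wpM2l // (cF i ci v v0).2.
Qed.

(** The first [M] factors are only known not to expand; the following ones
    are grouped in [K] blocks of [m] factors. *)
Lemma contracts_blocks (F : nat -> 'M[R]_p) (M m K : nat) (r : nat -> R) :
  (forall i, contracts 1 (F i)) -> (forall b, 0 <= r b) ->
  (forall b, (b < K)%N ->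
     contracts (r b) (\prod_(M + b * m <= i < M + b.+1 * m) F i)) ->
  contracts (\prod_(b < K) r b) (\prod_(0 <= i < M + K * m) F i).
Proof.
move=> cF r0; elim: K => [|K IHK] cb.
  by rewrite big_ord0; apply: contracts_prod1.
rewrite big_ord_recr /= (@big_cat_nat _ _ _ (M + K * m)) //=; last first.
  by rewrite leq_add2l leq_mul2r leqnSn orbT.
apply: contracts_mul => //; last exact: cb.
by apply: IHK => b /ltnW bK; apply: cb.
Qed.

End NonnegativeMatrices.

(** * Walk matrices and distance to uniformity *)

Section WalkMatrices.
Variables (R : realType) (gT : finGroupType).
Implicit Types (mu : gT -> R) (g h : gT).

(** Right translation by [g], as a permutation matrix. *)
Definition transl_mx g : 'M[R]_#|gT| := walk_mx (fun h => (h == g)%:R).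

Lemma transl_mxE g i j :
  transl_mx g i j = (enum_val j == enum_val i * g)%g%:R.
Proof.
by rewrite mxE -(inj_eq (mulgI (enum_val i))) mulKVg.
Qed.

Lemma transl_mx1 : transl_mx 1%g = 1.
Proof.
by apply/matrixP => i j; rewrite transl_mxE mxE mulg1 (inj_eq enum_val_inj) eq_sym.
Qed.

Lemma transl_mxM g h : transl_mx (g * h)%g = transl_mx g * transl_mx h.
Proof.
apply/matrixP => i j; rewrite transl_mxE mxE.
rewrite (bigD1 (enum_rank (enum_val i * g)%g)) //= big1 => [|k kP].
  by rewrite !transl_mxE enum_rankK eqxx mul1r addr0 mulgA.
by rewrite transl_mxE -(inj_eq enum_rank_inj) enum_valK (negPf kP) mul0r.
Qed.

(** Hence laws of products of independent group elements are rows of products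
    of walk matrices, and laws of arbitrary random elements are mixtures of
    translation matrices. *)
Lemma transl_mx_prod (I : Type) (s : seq I) (P : pred I) (F : I -> gT) :
  transl_mx (\prod_(i <- s | P i) F i)%g = \prod_(i <- s | P i) transl_mx (F i).
Proof. by rewrite (big_morph _ transl_mxM transl_mx1). Qed.

Lemma walk_mx_transl mu : walk_mx mu = \sum_g mu g *: transl_mx g.
Proof.
apply/matrixP => i j; rewrite summxE mxE.
rewrite (bigD1 ((enum_val i)^-1 * enum_val j)%g) //= big1 => [|g gP].
  by rewrite !mxE eqxx mulr1 addr0.
by rewrite !mxE eq_sym (negPf gP) mulr0.
Qed.

Lemma walk_mx_ge0 mu i j : (forall g, 0 <= mu g) -> 0 <= walk_mx mu i j.
Proof. by move=> mu0; rewrite mxE. Qed.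

Lemma sum_enum_val (F : gT -> R) : \sum_(i < #|gT|) F (enum_val i) = \sum_g F g.
Proof. by rewrite [RHS]big_enum_val. Qed.

Lemma walk_mx_stochastic mu : is_prob_mass mu -> stochastic (walk_mx mu).
Proof.
move=> [mu0 mu1]; split=> [i j|i]; first exact: walk_mx_ge0.
under eq_bigr do rewrite mxE.
rewrite (sum_enum_val (fun g => mu ((enum_val i)^-1 * g)%g)) -mu1.
by rewrite [RHS](reindex_inj (mulgI (enum_val i)^-1%g)).
Qed.

Lemma transl_mx_contracts1 g : contracts 1 (transl_mx g).
Proof.
apply/stochastic_contracts1/walk_mx_stochastic; split=> [h|]; first exact: ler0n.
by rewrite (bigD1 g) //= eqxx big1 ?addr0 // => h /negPf->.
Qed.

(** The law with mass function [f] is row [1] of its walk matrix, and the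
    uniform law is invariant; so their difference is the image of
    [delta_1 - uniform], a vector of total mass zero and l1 norm at most 2. *)
Lemma contracts_tv_dist (r : R) (f : gT -> R) :
  0 <= r -> \sum_g f g = 1 -> contracts r (walk_mx f) ->
  tv_dist f (@uniform_mass R gT) <= r.
Proof.
move=> r0 f1 cf; set o := enum_rank (1%g : gT); set u := @uniform_mass R gT.
have G0 : #|gT|%:R != 0 :> R.
  by rewrite pnatr_eq0 -lt0n; apply/card_gt0P; exists 1%g.
have u_sum : \sum_(j < #|gT|) u (enum_val j) = 1.
  by rewrite sumr_const card_ord -(mulr_natr _ #|gT|) mulVf.
pose v : 'rV[R]_#|gT| := \row_j ((j == o)%:R - u (enum_val j)).
have o_sum : \sum_j (j == o)%:R = 1 :> R.
  by rewrite (bigD1 o) //= eqxx big1 ?addr0 // => j /negPf->.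
have v0 : \sum_j v 0 j = 0.
  by under eq_bigr do rewrite mxE; rewrite sumrB u_sum o_sum subrr.
have v2 : l1norm v <= 2.
  apply: (@le_trans _ _ (\sum_j ((j == o)%:R + u (enum_val j)))).
    apply: ler_sum => j _; rewrite mxE (le_trans (ler_normB _ _)) //.
    by rewrite !ger0_norm ?ler0n // invr_ge0 ler0n.
  by rewrite big_split /= o_sum u_sum.
have [_ vf] := cf v v0.
have -> : tv_dist f u = 2^-1 * l1norm (v *m walk_mx f).
  congr (_ * _); rewrite -(sum_enum_val (fun g => `|f g - u g|)).
  apply: eq_bigr => j _; congr (`|_|); rewrite mxE.
  under eq_bigr do rewrite 2!mxE mulrBl; rewrite sumrB; congr (_ - _).
    rewrite (bigD1 o) //= eqxx mul1r enum_rankK invg1 mul1g big1 ?addr0 //.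
    by move=> i /negPf->; rewrite mul0r.
  rewrite -mulr_sumr (sum_enum_val (fun g => f (g^-1 * enum_val j)%g)).
  have inj_div : injective (fun g : gT => enum_val j * g^-1)%g.
    by move=> g h /mulgI/invg_inj.
  rewrite (reindex_inj inj_div) /=.
  under eq_bigr do rewrite invMg invgK mulgKV.
  by rewrite f1 mulr1.
apply: (@le_trans _ _ (2^-1 * (r * 2))); last by rewrite mulrCA mulVf ?mulr1.
by rewrite ler_wpM2l // (le_trans vf) // ler_wpM2l.
Qed.

(** By primitivity, [m] independent steps reach every element with a positive
    probability. Keeping [theta] away from 0 makes its inverse available as a
    penalty later. *)
Lemma walk_block_contracts mu :
  is_prob_mass mu -> irreducible_chain (walk_mx mu) ->
  aperiodic_chain (walk_mx mu) ->
  exists2 m, (0 < m)%N & exists2 theta : R, 0 < theta < 1 &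
    contracts theta (walk_mx mu ^+ m).
Proof.
move=> mu_mass irr aper; have st := walk_mx_stochastic mu_mass.
have [m m_gt0 A_gt0] := primitive_chain st.1 irr aper.
set A := walk_mx mu ^+ m in A_gt0 *; exists m => //.
pose o := enum_rank (1%g : gT).
have [eps eps_gt0 le_eps] : exists2 eps : R, 0 < eps & forall i j, eps <= A i j.
  pose F ij := A ij.1 ij.2.
  case: (arg_minP F (i0 := (o, o)) (P := xpredT) isT) => -[i0 j0] _ minF.
  by exists (A i0 j0) => // i j; apply: (minF (i, j)).
have G0 : 0 < #|gT|%:R :> R by rewrite ltr0n; apply/card_gt0P; exists 1%g.
exists (Num.max 2^-1 (1 - #|gT|%:R * eps)).
  rewrite lt_max invr_gt0 ltr0n /= gt_max invf_lt1 ?ltr1n ?ltr0n //=.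
  by rewrite gtrBl mulr_gt0.
apply: contracts_le (stochastic_contracts (stochasticX _ st) le_eps).
by rewrite le_max lexx orbT.
Qed.

End WalkMatrices.

(** * Conditioning on the genealogy *)

Section Genealogy.
Variables (R : realType) (gT : finGroupType) (mu : gT -> R) (n : nat).
Hypothesis mu_mass : is_prob_mass mu.

(** [a i = None] means that step [i] is fresh, [a i = Some k] that it copies
    step [k]; steps are numbered from 0. *)
Implicit Types (a : {ffun 'I_n -> option 'I_n}) (y z : {ffun 'I_n -> gT}).

Local Notation sample := {ffun 'I_n -> gT}.

Definition parent a i := odflt i (a i).

(** As parents are earlier than children, [n] steps up the genealogy lead to
    the fresh step from which step [i] ultimately takes its value. *)
Definition ancestor a i := iter n (parent a) i.

Definition splice (A : Type) (D : pred 'I_n) (y z : {ffun 'I_n -> A}) :=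
  [ffun i => if D i then z i else y i].

(** Exchanging the coordinates selected by [D] is a weight-preserving
    involution on pairs of samples, so splicing two independent samples of a
    product law gives again a sample of that law. *)
Lemma resample (V : lmodType R) (D : pred 'I_n) (H : sample -> V) :
  \sum_(y : sample) (\prod_i mu (y i)) *: H y =
  \sum_(y : sample) (\prod_i mu (y i)) *: \sum_(z : sample) (\prod_i mu (z i)) *: H (splice D y z).
Proof.
pose wt (yz : sample * sample) :=
  \prod_i (mu (yz.1 i) * mu (yz.2 i)).
have wt_sum : \sum_(z : sample) \prod_i mu (z i) = 1.
  by rewrite -(bigA_distr_bigA (fun _ => mu)) big1 // => i _; rewrite mu_mass.2.
pose swap (yz : sample * sample) :=
  (splice D yz.1 yz.2, splice D yz.2 yz.1).
have swapK : involutive swap.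
  by move=> [y z]; congr pair; apply/ffunP => i; rewrite !ffunE; case: (D i).
have wt_swap yz : wt (swap yz) = wt yz.
  by apply: eq_bigr => i _ /=; rewrite !ffunE; case: (D i); rewrite // mulrC.
transitivity (\sum_yz wt yz *: H yz.1).
  rewrite -(pair_bigA _ (fun y z => wt (y, z) *: H y)) /=; apply: eq_bigr => y _.
  rewrite -scaler_suml; congr (_ *: _).
  by under [RHS]eq_bigr do rewrite /wt big_split /=; rewrite -mulr_sumr wt_sum mulr1.
rewrite (reindex_inj (inv_inj swapK)) /=; under eq_bigr do rewrite wt_swap.
rewrite -(pair_bigA _ (fun y z => wt (y, z) *: H (splice D y z))) /=.
apply: eq_bigr => y _; rewrite scaler_sumr; apply: eq_bigr => z _.
by rewrite scalerA /wt big_split.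
Qed.

Variables (J : finType) (blk : 'I_n -> J).

Definition fresh a b := [forall i, (blk i == b) ==> (a i == None)].

Definition copied a b := [exists i, if a i is Some k then blk k == b else false].

(** In a good block every sample is read exactly once, at its own step. *)
Definition good a b := fresh a b && ~~ copied a b.

(** The walk matrix of the law of the walk given the genealogy [a]. *)
Definition law_mx a : 'M[R]_#|gT| :=
  \sum_(y : sample) (\prod_i mu (y i)) *: transl_mx R (\prod_i y (ancestor a i))%g.

(** A copied step lies in a block that is copied, hence not good; so no step
    outside the good blocks reads a sample of a good block. *)
Lemma parent_bad a i : ~~ good a (blk i) -> ~~ good a (blk (parent a i)).
Proof.
rewrite /parent; case ai: (a i) => [k|] //= _.
rewrite negb_and negbK; apply/orP; right.
by apply/existsP; exists i; rewrite ai.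
Qed.

Lemma ancestor_bad a i : ~~ good a (blk i) -> ~~ good a (blk (ancestor a i)).
Proof.
move=> bad_i; have bad k : ~~ good a (blk (iter k (parent a) i)).
  by elim: k => //= k; apply: parent_bad.
exact: bad.
Qed.

Lemma ancestor_good a i : good a (blk i) -> ancestor a i = i.
Proof.
case/andP => /forallP/(_ i); rewrite eqxx => /eqP ai _.
by rewrite /ancestor iter_fix // /parent ai.
Qed.

(** Given the genealogy, the samples used in good blocks are independent of
    those used elsewhere: the latter may be frozen, and then the good steps
    remain independent with law [mu] and all other steps are deterministic. *)
Lemma law_mx_frozen a :
  law_mx a = \sum_(y : sample) (\prod_i mu (y i)) *: \prod_i
    (if good a (blk i) then walk_mx mu else transl_mx R (y (ancestor a i))).
Proof.
rewrite /law_mx (resample (fun i => good a (blk i))).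
apply: eq_bigr => y _; congr (_ *: _).
pose F i g := mu g *: transl_mx R (if good a (blk i) then g else y (ancestor a i)).
rewrite (eq_bigr (fun i => \sum_g F i g)) => [|i _].
  rewrite (bigA_distr_bigA F); apply: eq_bigr => z _.
  rewrite transl_mx_prod prod_scalemx; congr (_ *: _); apply: eq_bigr => i _.
  rewrite ffunE; have [good_i|bad_i] := boolP (good a (blk i)).
    by rewrite ancestor_good // good_i.
  by rewrite (negPf (ancestor_bad bad_i)).
rewrite /F; case: ifP => _; first by rewrite walk_mx_transl.
by rewrite -scaler_suml mu_mass.2 scale1r.
Qed.

End Genealogy.

Section Blocks.
Variables (M m K n : nat).
Hypothesis window : n.+1 = (M + K * m)%N.

(** Block 0 consists of the first [M] steps; the others cut the window, that is
    the last [K * m] steps, in runs of [m] steps. *)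
Definition block (i : 'I_n.+1) : 'I_K.+1 :=
  inord (if (i < M)%N then 0 else ((i - M) %/ m).+1).

Lemma block0 (i : 'I_n.+1) : (block i == ord0) = (i < M)%N.
Proof.
rewrite -val_eqE /= /block; case: ifP => [_|/negbT]; first by rewrite inordK.
rewrite -leqNgt => le_Mi; have lt_i := ltn_ord i; have m_gt0 : (0 < m)%N by nia.
by rewrite inordK // ltnS ltn_divLR //; lia.
Qed.

Lemma blockS (i : 'I_n.+1) b : (b < K)%N ->
  (block i == inord b.+1) = (M + b * m <= i < M + b.+1 * m)%N.
Proof.
move=> lt_b; rewrite -val_eqE /= /block (inordK (_ : b.+1 < K.+1)%N) //.
case: ltnP => [lt_iM|le_Mi].
  by rewrite inordK //; apply/esym/negbTE; nia.
have lt_i := ltn_ord i; have m_gt0 : (0 < m)%N by nia.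
rewrite inordK ?ltnS ?ltn_divLR ?eqSS; try lia.
by rewrite eqn_leq leq_divRL // -ltnS ltn_divLR //; nia.
Qed.

Lemma card_block b : b != ord0 -> (#|[pred i | block i == b]| <= m)%N.
Proof.
case: b => -[//|b] lt_b _; have bP i := @blockS i b lt_b.
have -> : Ordinal lt_b = inord b.+1 by apply: val_inj; rewrite /= inordK.
rewrite -[leqRHS]card_ord.
pose f (t : 'I_m) : 'I_n.+1 := inord (M + b * m + t).
apply: (@leq_trans #|[seq f t | t : 'I_m]|); last first.
  by rewrite (leq_trans (card_size _)) // size_map -cardE.
apply: subset_leq_card; apply/fintype.subsetP => i; rewrite inE bP => /andP[le_i lt_i].
have lt_t : (i - (M + b * m) < m)%N by rewrite ltn_subLR //; nia.
apply/fintype.imageP; exists (Ordinal lt_t) => //; apply: val_inj.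
by rewrite /f /= subnKC // inord_val.
Qed.

Variables (R : realType) (gT : finGroupType) (mu : gT -> R) (theta : R).
Hypothesis mu_mass : is_prob_mass mu.
Hypothesis theta01 : 0 < theta < 1.
Hypothesis mu_m : contracts theta (walk_mx mu ^+ m).

(** A good block contributes [m] consecutive factors [walk_mx mu]. Isolated
    fresh steps would not do: separated by fixed translations, they may fail to
    contract at all. *)
Lemma law_mx_contracts a :
  contracts (theta ^+ #|[pred b | (b != ord0) && good block a b]|) (law_mx mu a).
Proof.
set gd := good block a.
have mu_ge0 := mu_mass.1.
have theta0 : 0 <= theta by case/andP: theta01 => /ltW.
rewrite (law_mx_frozen mu_mass block); set r := theta ^+ _.
have -> : r = \sum_(y : {ffun 'I_n.+1 -> gT}) (\prod_i mu (y i)) * r.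
  rewrite -mulr_suml -(bigA_distr_bigA (fun _ => mu)) big1 ?mul1r // => i _.
  by rewrite mu_mass.2.
apply: contracts_sum => [y|y _]; first exact: prodr_ge0.
pose F i : 'M[R]_#|gT| :=
  if gd (block i) then walk_mx mu else transl_mx R (y (ancestor a i)).
have cF i : contracts 1 (F i).
  rewrite /F; case: ifP => _; last exact: transl_mx_contracts1.
  exact/stochastic_contracts1/walk_mx_stochastic.
rewrite -/gd (eq_bigr F) // (eq_bigr (fun i : 'I_n.+1 => F (inord i))) => [|i _]; last first.
  by rewrite inord_val.
rewrite -(big_mkord xpredT (fun i => F (inord i))) window.
have -> : r = \prod_(b < K) (if gd (inord b.+1) then theta else 1).
  rewrite /r -prodr_const big_mkcond big_ord_recl /= mul1r.
  apply: eq_bigr => b _; rewrite inE /=.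
  suff -> : lift ord0 b = inord b.+1 by [].
  by apply: val_inj; rewrite /= inordK // ltnS ltn_ord.
apply: (contracts_blocks (r := fun b => if gd (inord b.+1) then theta else 1)).
- by move=> i; apply: cF.
- by move=> b; case: ifP.
move=> b lt_b; case: ifP => gd_b; last by apply: contracts_prod1 => i; apply: cF.
rewrite (eq_big_nat _ _ (F2 := fun=> walk_mx mu)) => [|i /andP[le_i lt_i]].
  by rewrite prodr_const_nat mulSn addnA addnAC addKn.
have lt_in : (i < n.+1)%N by rewrite window; nia.
have /eqP bi : block (inord i) == inord b.+1 by rewrite blockS // inordK // le_i.
by rewrite /F bi gd_b.
Qed.

End Blocks.

(** * Averaging over the genealogy *)

Lemma sum_option (V : nmodType) (T : finType) (F : option T -> V) :
  \sum_x F x = F None + \sum_t F (Some t).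
Proof.
rewrite (bigD1 None) //=; congr (_ + _).
rewrite (reindex_omap Some id) => [|[t|]] //=.
by apply: eq_bigl => t; rewrite eqxx.
Qed.

(** Functions of the coordinates in disjoint blocks are independent under a
    product weight. The factor attached to a block is a combination of two
    product functions, which is all that is needed below. *)
Lemma sum_prod_blocks (R : comNzRingType) (I J A : finType) (blk : I -> J)
    (w : I -> A -> R) (F : bool -> A -> R) (c : J -> bool -> R) :
  \sum_(a : {ffun I -> A}) (\prod_i w i (a i)) *
    \prod_j \sum_s c j s * \prod_(i | blk i == j) F s (a i) =
  \prod_j \sum_s c j s * \prod_(i | blk i == j) \sum_x w i x * F s x.
Proof.
have prodE (G : bool -> I -> R) :
    \prod_j \sum_s c j s * \prod_(i | blk i == j) G s i =
    \sum_(sg : {ffun J -> bool}) (\prod_j c j (sg j)) * \prod_i G (sg (blk i)) i.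
  rewrite (bigA_distr_bigA (fun j s => c j s * \prod_(i | blk i == j) G s i)).
  apply: eq_bigr => sg _; rewrite big_split /=; congr (_ * _).
  rewrite [RHS](partition_big blk xpredT) //=; apply: eq_bigr => j _.
  by apply: eq_bigr => i /eqP->.
rewrite (prodE (fun s i => \sum_x w i x * F s x)).
under eq_bigr do rewrite (prodE (fun s i => F s (_ i))) mulr_sumr.
rewrite exchange_big /=; apply: eq_bigr => sg _.
rewrite (bigA_distr_bigA (fun i x => w i x * F (sg (blk i)) x)) mulr_sumr.
by apply: eq_bigr => a _; rewrite big_split mulrCA.
Qed.

Section Averaging.
Variables (R : realType) (n : nat) (alpha : R).
Hypothesis alpha01 : 0 <= alpha < 1.
Implicit Types (i k : 'I_n.+1) (x : option 'I_n.+1).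

(** The law of the source of step [i]; as steps are numbered from 0, step [i]
    has [i] predecessors. *)
Definition source_law i x : R :=
  match x with
  | None => if i == ord0 then 1 else 1 - alpha
  | Some k => if (k < i)%N then alpha / i%:R else 0
  end.

Lemma source_law_ge0 i x : 0 <= source_law i x.
Proof.
case/andP: alpha01 => alpha0 alpha1; case: x => [k|] /=; case: ifP => //.
  by rewrite divr_ge0.
by rewrite subr_ge0 ltW.
Qed.

Lemma source_law_sum i : \sum_x source_law i x = 1.
Proof.
rewrite sum_option /= -big_mkcond /=.
rewrite -(big_ord_widen _ (fun=> alpha / i%:R)) 1?ltnW //.
rewrite sumr_const card_ord; case: eqVneq => [->|i_neq0].
  by rewrite mulr0n addr0.
by rewrite -(mulr_natr (alpha / i%:R)) divfK ?subrK // pnatr_eq0.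
Qed.

Variables (M m K : nat) (theta : R).
Hypothesis window : n.+1 = (M + K * m)%N.
Hypothesis M_gt0 : (0 < M)%N.
Hypothesis theta01 : 0 < theta < 1.

Local Notation blk := (@block M m K n).

(** A source is late when it lies in the window. *)
Definition late x := if x is Some k then (M <= k)%N else false.

(** A fresh block of the window that is not good contains the source of some
    step, and that source is late; different blocks are spoiled by different
    steps. *)
Lemma fresh_le_good_late (a : {ffun 'I_n.+1 -> option 'I_n.+1}) :
  (#|[pred b | (b != ord0) && fresh blk a b]|
   <= #|[pred b | (b != ord0) && good blk a b]| + #|[pred i | late (a i)]|)%N.
Proof.
set G := [pred b | (b != ord0) && good blk a b].
set L := [pred i | late (a i)].
apply: (@leq_trans (#|G| + #|[seq blk (parent a i) | i in L]|)%N); last first.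
  by rewrite leq_add2l leq_image_card.
rewrite -cardUI (leq_trans _ (leq_addr _ _)) //.
apply: subset_leq_card; apply/fintype.subsetP => b; rewrite !inE.
case/andP=> b0 fresh_b; rewrite b0 /good fresh_b /=.
case: (boolP (copied blk a b)) => //= /existsP[i].
case ai: (a i) => [k|] // /eqP kb.
apply/fintype.imageP; exists i; last by rewrite /parent ai.
by rewrite inE ai /= leqNgt -(block0 window) kb.
Qed.

(** The bound [theta ^+ (number of fresh blocks) / theta ^+ (number of late
    sources)] is a product over blocks. As a fresh block has no late source, the
    factor of a block of the window is the product of its late factors, minus
    [1 - theta] when the block is fresh; [block_factor] and [block_coef] present
    it as a combination of two product functions. Block 0 only receives the late
    factors. *)
Definition late_factor x : R := if late x then theta^-1 else 1.

Definition block_factor (s : bool) x : R :=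
  if s then (x == None)%:R else late_factor x.

Definition block_coef (b : 'I_K.+1) (s : bool) : R :=
  if s then (if b == ord0 then 0 else theta - 1) else 1.

Lemma block_factorE (a : {ffun 'I_n.+1 -> option 'I_n.+1}) b :
  \sum_s block_coef b s * \prod_(i | blk i == b) block_factor s (a i) =
  (if (b != ord0) && fresh blk a b then theta else 1) *
  \prod_(i | blk i == b) late_factor (a i).
Proof.
rewrite big_bool /= mul1r; case: eqP => _ /=; first by rewrite mul0r add0r mul1r.
case: ifP => [/forallP fresh_b|/negbT/forallPn[i]]; last first.
  rewrite negb_imply => /andP[bi /negPf ai].
  by rewrite (bigD1 i) //= ai mul0r mulr0 add0r mul1r.
have aN i : blk i == b -> a i = None by move: (fresh_b i) => /implyP h /h/eqP.
rewrite big1 => [|i /aN->]; last by rewrite eqxx.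
by rewrite big1 => [|i /aN->] //; rewrite !mulr1 subrK.
Qed.

Lemma good_le_block_factors (a : {ffun 'I_n.+1 -> option 'I_n.+1}) :
  theta ^+ #|[pred b | (b != ord0) && good blk a b]| <=
  \prod_b \sum_s block_coef b s * \prod_(i | blk i == b) block_factor s (a i).
Proof.
case/andP: theta01 => theta0 theta1.
under eq_bigr do rewrite block_factorE.
rewrite big_split /=.
have -> : \prod_b \prod_(i | blk i == b) late_factor (a i) =
    \prod_i late_factor (a i) by rewrite [RHS](partition_big blk xpredT).
rewrite -!big_mkcond /=.
rewrite !prodr_const exprVn ler_pdivlMr ?exprn_gt0 // -exprD.
by rewrite ler_wiXn2l ?(ltW theta0) ?(ltW theta1) // fresh_le_good_late.
Qed.

Variable p : R.
(** [p] bounds the probability that the source of a given step is late. *)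
Hypothesis window_small : (K * m)%:R <= p * M%:R.
Hypothesis p_small :
  (1 + (theta^-1 - 1) * p) ^+ m <= 1 + (1 - alpha) ^+ m * (1 - theta) / 2.

Lemma eta_ge0 : 0 <= theta^-1 - 1.
Proof.
by case/andP: theta01 => theta0 theta1; rewrite subr_ge0 invf_ge1 // ltW.
Qed.

(** Each of the [K * m] possible late sources has probability at most [M^-1],
    and none is possible for the steps before the window. *)
Lemma late_prob_le i : \sum_x source_law i x * (late x)%:R <= p.
Proof.
case/andP: alpha01 => alpha0 alpha1.
have M0 : 0 < M%:R :> R by rewrite ltr0n.
have p0 : 0 <= p by rewrite -(pmulr_lge0 _ M0) (le_trans _ window_small).
rewrite sum_option mulr0 add0r; case: (leqP M i) => [le_Mi|lt_iM]; last first.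
  rewrite big1 // => k _; rewrite /source_law /=; case: ifP => [lt_ki|_]; last by rewrite mul0r.
  by rewrite leqNgt (ltn_trans lt_ki lt_iM) mulr0.
apply: (@le_trans _ _ (\sum_(k < n.+1 | (M <= k)%N) M%:R^-1)).
  rewrite [leRHS]big_mkcond; apply: ler_sum => k _ /=.
  case: (leqP M k) => _; last by rewrite mulr0.
  rewrite mulr1; case: ifP => _; last by rewrite invr_ge0 ltW.
  rewrite -[leRHS]mul1r ler_pM ?invr_ge0 ?(ltW alpha1) //.
  by rewrite lef_pV2 ?posrE ?ltr0n ?ler_nat // (leq_trans M_gt0 le_Mi).
rewrite -(big_geq_mkord _ _ xpredT (fun=> M%:R^-1)) sumr_const_nat window addKn.
by rewrite -(mulr_natl M%:R^-1) ler_pdivrMr ?ltr0n.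
Qed.

Lemma mean_late_factor i :
  \sum_x source_law i x * late_factor x =
  1 + (theta^-1 - 1) * \sum_x source_law i x * (late x)%:R.
Proof.
rewrite -{1}(source_law_sum i) mulr_sumr -big_split; apply: eq_bigr => x _ /=.
by rewrite /late_factor; case: (late x); rewrite /=; ring.
Qed.

Lemma mean_late_factor_ge1 i : 1 <= \sum_x source_law i x * late_factor x.
Proof.
rewrite mean_late_factor lerDl mulr_ge0 ?eta_ge0 // sumr_ge0 // => x _.
by rewrite mulr_ge0 ?source_law_ge0 ?ler0n.
Qed.

Lemma mean_late_factor_old i : (i < M)%N ->
  \sum_x source_law i x * late_factor x = 1.
Proof.
move=> lt_iM; rewrite -(source_law_sum i); apply: eq_bigr => -[k|] _ /=.
  case: ifP => [lt_ki|_]; last by rewrite mul0r.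
  by rewrite /late_factor /= leqNgt (ltn_trans lt_ki lt_iM) mulr1.
by rewrite mulr1.
Qed.

(** A block is fresh with probability at least [(1 - alpha) ^+ m], and late
    sources are so rare that their penalty costs only half of that gain. *)
Lemma mean_block_factor b :
  0 <= \sum_s block_coef b s *
         \prod_(i | blk i == b) \sum_x source_law i x * block_factor s x <=
  if b == ord0 then 1 else 1 - (1 - alpha) ^+ m * (1 - theta) / 2.
Proof.
case/andP: alpha01 => alpha0 alpha1; case/andP: theta01 => theta0 theta1.
rewrite big_bool /= mul1r; case: eqVneq => [->|b0].
  rewrite mul0r add0r big1 ?ler01 ?lexx // => i.
  by rewrite (block0 window) => /mean_late_factor_old.
have -> : \prod_(i | blk i == b) \sum_x source_law i x * (x == None)%:R =
    (1 - alpha) ^+ #|[pred i | blk i == b]|.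
  rewrite -prodr_const; apply: eq_bigr => i /eqP bi.
  rewrite sum_option eqxx mulr1 big1 => [|k _]; last by rewrite mulr0.
  rewrite addr0 /=; case: eqP => // i0; case/negP: b0.
  by rewrite -bi (block0 window) i0.
set N := #|_|; have le_Nm : (N <= m)%N := card_block window b0.
have alpha'0 : 0 <= 1 - alpha by lra.
have alpha'1 : 1 - alpha <= 1 by lra.
have qm : (1 - alpha) ^+ m <= (1 - alpha) ^+ N by rewrite ler_wiXn2l.
have qN1 : (1 - alpha) ^+ N <= 1 by rewrite exprn_ile1.
have qN0 : 0 <= (1 - alpha) ^+ N by rewrite exprn_ge0.
set A := \prod_(i | _) _.
have A1 : 1 <= A.
  rewrite /A; elim/big_ind: _ => // [u v u1 v1|i _]; last exact: mean_late_factor_ge1.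
  by rewrite -[1]mulr1 ler_pM.
have Am : A <= (1 + (theta^-1 - 1) * p) ^+ m.
  apply: (@le_trans _ _ ((1 + (theta^-1 - 1) * p) ^+ N)).
    rewrite /A /N -prodr_const; apply: ler_prod => i _.
    rewrite (le_trans ler01 (mean_late_factor_ge1 i)) mean_late_factor /=.
    by rewrite lerD2l ler_wpM2l ?eta_ge0 // late_prob_le.
  have M0 : 0 < M%:R :> R by rewrite ltr0n.
  have p0 : 0 <= p by rewrite -(pmulr_lge0 _ M0) (le_trans _ window_small).
  by rewrite ler_weXn2l // lerDl mulr_ge0 ?eta_ge0.
have := le_trans Am p_small; move: qm qN1 qN0 A1.
set q := (1 - alpha) ^+ m; set qN := (1 - alpha) ^+ N => qm qN1 qN0 A1 Aq.
apply/andP; split; nra.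
Qed.

Lemma mean_good_le :
  \sum_(a : {ffun 'I_n.+1 -> option 'I_n.+1}) (\prod_i source_law i (a i)) *
    theta ^+ #|[pred b | (b != ord0) && good blk a b]| <=
  (1 - (1 - alpha) ^+ m * (1 - theta) / 2) ^+ K.
Proof.
apply: (@le_trans _ _ (\sum_(a : {ffun 'I_n.+1 -> option 'I_n.+1})
    (\prod_i source_law i (a i)) *
    \prod_b \sum_s block_coef b s * \prod_(i | blk i == b) block_factor s (a i))).
  apply: ler_sum => a _; rewrite ler_wpM2l ?good_le_block_factors //.
  by apply: prodr_ge0 => i _; apply: source_law_ge0.
rewrite sum_prod_blocks.
apply: le_trans.
  by apply: ler_prod => b _; apply: mean_block_factor.
by rewrite big_ord_recl eqxx mul1r /= prodr_const card_ord.
Qed.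

End Averaging.

(** * The law of the reinforced walk *)

Lemma rv_mass_comp (d : measure_display) (T : measurableType d) (R : realType)
    (P : probability T R) (C : finType) (A : eqType) (Z : T -> C) (f : C -> A)
    (g : A) :
  (forall c, measurable (Z @^-1` [set c])) ->
  rv_mass P (f \o Z) g = \sum_(c | f c == g) rv_mass P Z c.
Proof.
move=> mZ; rewrite /rv_mass.
have -> : (f \o Z) @^-1` [set g] =
    \bigcup_(c in [set` [pred c | f c == g]]) Z @^-1` [set c].
  apply/seteqP; split=> [w /= <-|w [c /= /eqP <- <-] //].
  by exists (Z w); rewrite //= inE.
rewrite measure_fin_bigcup //; last by move=> c c' _ _ [w [<- <-]].
rewrite -(bigfs _ (r := index_enum C)) ?index_enum_uniq //; last first.
  by move=> c _; rewrite mem_index_enum.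
rewrite (eq_bigr (fun c => (fine (P (Z @^-1` [set c])))%:E)) ?sumEFin // => c _.
by rewrite fineK ?fin_num_measure.
Qed.

Section LawOfWalk.
Variables (d : measure_display) (T : measurableType d) (R : realType).
Variables (P : probability T R) (gT : finGroupType) (mu : gT -> R) (alpha : R).
Variables (xi : nat -> T -> bool) (u : nat -> T -> nat) (Y X S : nat -> T -> gT).
Hypothesis alpha01 : 0 <= alpha < 1.
Hypothesis driver : srrw_driver P mu alpha xi u Y.
Hypothesis X1 : forall w, X 1%N w = Y 1%N w.
Hypothesis XE : forall n w, (1 < n)%N ->
  X n w = if xi n w then X (u n w) w else Y n w.
Hypothesis S0 : forall w, S 0%N w = 1%g.
Hypothesis SE : forall n w, (1 <= n)%N -> S n w = (S n.-1 w * X n w)%g.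
Variable n : nat.

(** Step [i] is the one usually numbered [i.+1]; the first step is fresh by
    convention, as its [xi] and [u] are unconstrained. *)
Definition genealogy w : {ffun 'I_n.+1 -> option 'I_n.+1} :=
  [ffun i : 'I_n.+1 => if (i != ord0) && xi i.+1 w
                       then Some (inord (u i.+1 w).-1) else None].

Definition samples w : {ffun 'I_n.+1 -> gT} := [ffun i : 'I_n.+1 => Y i.+1 w].

Lemma source_range (i : 'I_n.+1) w : i != ord0 -> (1 <= u i.+1 w <= i)%N.
Proof. by move=> i0; apply: (u_range driver w); rewrite ltnS lt0n. Qed.

Lemma step_ancestor w (i : 'I_n.+1) :
  X i.+1 w = samples w (ancestor (genealogy w) i).
Proof.
have stepE k : (i <= k)%N ->
    X i.+1 w = samples w (iter k (parent (genealogy w)) i).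
  elim: k i => [|k IHk] i le_ik.
    rewrite leqn0 in le_ik; rewrite ffunE /= (eqP le_ik); exact: X1.
  have [gi|] := boolP ((i != ord0) && xi i.+1 w).
    case/andP: (gi) => i0 xi1; have /andP[u_gt0 le_ui] := source_range w i0.
    have lt_un : ((u i.+1 w).-1 < n.+1)%N by have := ltn_ord i; lia.
    have pi : parent (genealogy w) i = inord (u i.+1 w).-1.
      by rewrite /parent ffunE gi.
    rewrite iterSr pi -IHk ?inordK //; last by lia.
    by rewrite prednK // XE ?xi1 // ltnS lt0n.
  move=> gi; have pi : parent (genealogy w) i = i by rewrite /parent ffunE (negPf gi).
  rewrite (iter_fix _ pi) ffunE; case: (eqVneq i ord0) gi => [-> _|i0 /= /negPf xi0].
    exact: X1.
  by rewrite XE ?xi0 // ltnS lt0n.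
by apply: stepE; rewrite ltnW.
Qed.

Definition endpoint (ay : {ffun 'I_n.+1 -> option 'I_n.+1} * {ffun 'I_n.+1 -> gT}) :=
  (\prod_i ay.2 (ancestor ay.1 i))%g.

Lemma walk_endpoint w : S n.+1 w = endpoint (genealogy w, samples w).
Proof.
rewrite /endpoint /=; under eq_bigr do rewrite -step_ancestor.
elim: n.+1 => [|k IHk]; first by rewrite big_ord0 S0.
by rewrite big_ord_recr SE //= IHk.
Qed.

Section Cell.
Variables (a : {ffun 'I_n.+1 -> option 'I_n.+1}) (y : {ffun 'I_n.+1 -> gT}).

(** When step [j.-1] is fresh, the value of [u j] is ignored, whence the
    event [setT]. *)
Definition driver_event (e : nat + nat + nat) : set T :=
  match e with
  | inl (inl j) => xi j @^-1` [set a (inord j.-1) != None]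
  | inl (inr j) => if a (inord j.-1) is Some k then u j @^-1` [set k.+1] else setT
  | inr j => Y j @^-1` [set y (inord j.-1)]
  end.

Definition driver_indices : seq (nat + nat + nat) :=
  [seq inl (inl j) | j <- index_iota 2 n.+2] ++
  [seq inl (inr j) | j <- index_iota 2 n.+2] ++
  [seq inr j | j <- index_iota 1 n.+2].

Lemma driver_indices_uniq : uniq driver_indices.
Proof.
have uniq_map (f : nat -> nat + nat + nat) (s : seq nat) :
    injective f -> uniq s -> uniq [seq f j | j <- s].
  by move=> f_inj; rewrite map_inj_uniq.
rewrite /driver_indices !cat_uniq !uniq_map ?iota_uniq ?andbT //; try by move=> j k [].
apply/andP; split; last apply/andP; split=> //; apply/hasPn => e.
  by rewrite mem_cat => /orP[] /mapP[j _ ->]; apply/mapP => -[].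
by case/mapP => j _ ->; apply/mapP => -[].
Qed.

Lemma driver_indicesP e : e \in driver_indices ->
  driver_index e /\ driver_events xi u Y e (driver_event e).
Proof.
have rv (A : Type) (Z : T -> A) (z : A) : rv_events Z (Z @^-1` [set z]).
  by exists [set z] => //; rewrite setTI.
rewrite !mem_cat => /or3P[] /mapP[j]; rewrite mem_index_iota => /andP[? _] -> //=.
split=> //; case: (a _) => [k|] //.
by exists setT => //; rewrite setTI preimage_setT.
Qed.

Lemma driver_event_measurable e : e \in driver_indices ->
  measurable (driver_event e).
Proof.
case/driver_indicesP; case: e => [[j|j]|j] /= le_j.
- exact: (xi_rv driver le_j).
- exact: (u_rv driver le_j).
- exact: (Y_rv driver le_j).
Qed.

Definition valid := [forall i, if a i is Some k then (k < i)%N else true].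

Definition cell : set T :=
  (fun w => (genealogy w, samples w)) @^-1` [set (a, y)].

Lemma cell_invalid : ~~ valid -> cell = set0.
Proof.
move=> /forallPn[i ai]; rewrite -subset0 => w [/ffunP/(_ i) + _].
rewrite ffunE; case: ifP ai => [/andP[i0 _]|_]; last by case: (a i).
case: (a i) => // k le_ik [] /(congr1 val) /=.
have := source_range w i0; have := ltn_ord i.
rewrite -leqNgt in le_ik => lt_in /andP[u_gt0 le_ui].
by rewrite inordK => [?|]; lia.
Qed.

Lemma cell_valid : valid ->
  cell = \bigcap_(e in [set` driver_indices]) driver_event e.
Proof.
move=> /forallP va; apply/seteqP; split=> [w [aE yE] e|w wE].
  rewrite /= !mem_cat => /or3P[] /mapP[j]; rewrite mem_index_iota => j_range -> /=.
  - rewrite -aE ffunE inordK; last by lia.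
    rewrite prednK; last by lia.
    rewrite -val_eqE /= inordK; last by lia.
    by rewrite (_ : j.-1 != 0)%N; [case: ifP | lia].
  - rewrite -aE ffunE inordK; last by lia.
    rewrite prednK; last by lia.
    case: ifP => //= _; have := u_range driver w (n := j).
    move=> /(_ _)/andP[|u_gt0 le_uj]; first by lia.
    by rewrite inordK ?prednK //; lia.
  - by rewrite -yE ffunE inordK ?prednK //; lia.
congr pair; apply/ffunP => i; have lt_i := ltn_ord i; rewrite ffunE.
  case: eqVneq => [->|i0] /=.
    by move: (va ord0); case: (a ord0).
  have i_gt0 : (0 < i)%N by rewrite lt0n.
  have := wE (inl (inl i.+1)); rewrite /= inord_val => ->; last first.
    by rewrite !mem_cat map_f // mem_index_iota; lia.
  have := wE (inl (inr i.+1)); rewrite /= inord_val; case: (a i) => [k|] //= -> //.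
    by rewrite inord_val.
  by rewrite !mem_cat map_f ?orbT // mem_index_iota; lia.
have := wE (inr i.+1); rewrite /= inord_val => -> //.
by rewrite !mem_cat map_f ?orbT // mem_index_iota; lia.
Qed.

Lemma cell_measurable : measurable cell.
Proof.
have [va|/cell_invalid->] := boolP valid; last exact: measurable0.
rewrite cell_valid //; apply: fin_bigcap_measurable; first exact: finite_seq.
by move=> e; apply: driver_event_measurable.
Qed.

Lemma source_event_law (i : 'I_n.+1) : valid -> i != ord0 ->
  (P (driver_event (inl (inl i.+1))) * P (driver_event (inl (inr i.+1))))%E =
  (source_law alpha i (a i))%:E.
Proof.
move=> /forallP/(_ i) va i0; rewrite /= inord_val.
have i_gt0 : (0 < i)%N by rewrite lt0n.
case: (a i) va => [k lt_ki|_] /=.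
  by rewrite lt_ki (xi_law driver) // (u_law driver) // -EFinM.
rewrite probability_setT mule1 (negPf i0).
have -> : xi i.+1 @^-1` [set false] = ~` (xi i.+1 @^-1` [set true]).
  by apply/seteqP; split=> w /=; case: (xi _ w).
rewrite probability_setC ?(xi_law driver) //.
by apply: (xi_rv driver _); last by exists [set true] => //; rewrite setTI.
Qed.

(** The cell is an intersection of independent driver events, two for the
    source of each step but the first and one for each sample; an invalid
    genealogy is impossible, and has weight 0. *)
Lemma cell_mass :
  P cell = ((\prod_i source_law alpha i (a i)) * \prod_i mu (y i))%:E.
Proof.
have [va|nva] := boolP valid; last first.
  rewrite cell_invalid // measure0; case/forallPn: nva => i.
  rewrite (bigD1 i) //=; case: (a i) => [k /negPf lt_ki|] //=.
  by rewrite lt_ki !mul0r.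
rewrite cell_valid //.
pose J : {fset nat + nat + nat} := seq_fset tt driver_indices.
have JE e : (e \in J) = (e \in driver_indices) by rewrite seq_fsetE.
have -> : [set` driver_indices] = [set` J] by apply/seteqP; split=> e; rewrite /= JE.
rewrite (driver_indep driver) => [|e]; last by rewrite JE => /driver_indicesP.
rewrite (perm_big _ (seq_fset_perm _ _)) undup_id ?driver_indices_uniq //.
rewrite /driver_indices !big_cat !big_map [LHS]muleA -big_split.
rewrite EFinM -!prodEFin; congr (_ * _)%E.
  rewrite big_add1 big_add1 big_mkord big_ord_recl.
  have a0 : a ord0 = None by move/forallP/(_ ord0): va; case: (a ord0).
  rewrite a0 /= mul1e; apply: eq_bigr => i _; rewrite -source_event_law //.
rewrite big_add1 big_mkord; apply: eq_bigr => i _.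
by rewrite /= inord_val (Y_law driver).
Qed.

End Cell.

Hypothesis mu_mass : is_prob_mass mu.

Definition history_mass
    (ay : {ffun 'I_n.+1 -> option 'I_n.+1} * {ffun 'I_n.+1 -> gT}) :=
  (\prod_i source_law alpha i (ay.1 i)) * \prod_i mu (ay.2 i).

Lemma walk_law g :
  rv_mass P (S n.+1) g = \sum_(ay | endpoint ay == g) history_mass ay.
Proof.
pose Z w := (genealogy w, samples w).
have -> : S n.+1 = endpoint \o Z by apply/funext => w; apply: walk_endpoint.
rewrite rv_mass_comp => [|[a y]]; last exact: cell_measurable.
by apply: eq_bigr => -[a y] _; rewrite /rv_mass cell_mass.
Qed.

Lemma walk_mass_sum : \sum_g rv_mass P (S n.+1) g = 1.
Proof.
transitivity (\sum_ay history_mass ay).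
  rewrite [RHS](partition_big endpoint xpredT) //.
  by apply: eq_bigr => g _; rewrite walk_law.
rewrite -(pair_bigA _ (fun a y => history_mass (a, y))) /history_mass /=.
under eq_bigr do rewrite -mulr_sumr -(bigA_distr_bigA (fun _ => mu)).
rewrite -mulr_suml -(bigA_distr_bigA (source_law alpha)).
rewrite big1 => [|i _]; last exact: source_law_sum.
by rewrite mul1r big1 // => i _; apply: mu_mass.2.
Qed.

(** Splitting the law into its conditional laws given the genealogy puts it in
    the form required by [contracts_sum]. *)
Lemma walk_law_mx :
  walk_mx (rv_mass P (S n.+1)) =
  \sum_(a : {ffun 'I_n.+1 -> option 'I_n.+1})
    (\prod_i source_law alpha i (a i)) *: law_mx mu a.
Proof.
rewrite walk_mx_transl.
transitivity (\sum_ay history_mass ay *: transl_mx R (endpoint ay)).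
  rewrite [RHS](partition_big endpoint xpredT) //=; apply: eq_bigr => g _.
  by rewrite walk_law scaler_suml; apply: eq_bigr => ay /eqP->.
rewrite -(pair_bigA _ (fun a y => history_mass (a, y) *: transl_mx R (endpoint (a, y)))) /=.
apply: eq_bigr => a _; rewrite scaler_sumr; apply: eq_bigr => y _.
by rewrite scalerA.
Qed.

End LawOfWalk.

(** * Exponential convergence *)

Lemma expr1D_le (R : realType) (x : R) (m : nat) :
  0 <= x <= 1 -> (1 + x) ^+ m <= 1 + 2 ^+ m * x.
Proof.
case/andP=> x0 x1.
(* The chord of the convex function [(1 + x) ^+ m] between 0 and 1. *)
suff : (1 + x) ^+ m <= 1 + (2 ^+ m - 1) * x by move=> le; apply: le_trans le _; nra.
elim: m => [|m IHm]; first by rewrite !expr0 subrr mul0r addr0.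
have c1 : 1 <= 2 ^+ m :> R by rewrite exprn_ege1 // ler1n.
rewrite !exprS; move: c1 IHm; set c := 2 ^+ m; set y := (1 + x) ^+ m => c1 IHm.
apply: (@le_trans _ _ ((1 + x) * (1 + (c - 1) * x))).
  by rewrite ler_wpM2l // addr_ge0.
have : 0 <= x * (1 - x) * (c - 1) by rewrite !mulr_ge0 ?subr_ge0.
by nra.
Qed.

(** This reduces the theorem to the choice of a window: long enough for [K] to be
    proportional to [n], short enough for [p] to be small. *)
Lemma srrw_tv_le (R : realType) (gT : finGroupType) (mu : gT -> R) (m : nat)
    (theta alpha p : R) (M K n : nat) (d : measure_display)
    (T : measurableType d) (P : probability T R) (S : nat -> T -> gT) :
  is_prob_mass mu -> 0 < theta < 1 -> contracts theta (walk_mx mu ^+ m) ->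
  0 <= alpha < 1 -> srrw P mu alpha S ->
  n.+1 = (M + K * m)%N -> (0 < M)%N -> (K * m)%:R <= p * M%:R ->
  (1 + (theta^-1 - 1) * p) ^+ m <= 1 + (1 - alpha) ^+ m * (1 - theta) / 2 ->
  tv_dist (rv_mass P (S n.+1)) (@uniform_mass R gT) <=
    (1 - (1 - alpha) ^+ m * (1 - theta) / 2) ^+ K.
Proof.
move=> mu_mass theta01 mu_m alpha01 [xi [u [Y [X [driver X1 XE S0 SE]]]]].
move=> window M_gt0 window_small p_small.
have le_mean := mean_good_le alpha01 window M_gt0 theta01 window_small p_small.
apply: contracts_tv_dist.
- apply: le_trans le_mean; apply: sumr_ge0 => a _.
  rewrite mulr_ge0 ?exprn_ge0 ?prodr_ge0 // => [i _|].
    exact: source_law_ge0.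
  by case/andP: theta01 => /ltW.
- exact: (walk_mass_sum alpha01 driver X1 XE S0 SE).
apply: contracts_le le_mean _.
rewrite (walk_law_mx alpha01 driver X1 XE S0 SE).
apply: contracts_sum => [a|a _]; last exact: law_mx_contracts.
by apply: prodr_ge0 => i _; apply: source_law_ge0.
Qed.

Lemma window_size (n m D : nat) (K := (n.+1 %/ (m * D.+1))%N) : (0 < D)%N ->
  [/\ (K * m * D <= n.+1 - K * m)%N, n.+1 = (n.+1 - K * m + K * m)%N &
      (0 < n.+1 - K * m)%N].
Proof.
move=> D_gt0; have : (K * m + K * m * D <= n.+1)%N.
  by rewrite -mulnS -mulnA leq_trunc_div.
have : (K * m <= K * m * D)%N by rewrite leq_pmulr.
by move: (K * m)%N => k; split; lia.
Qed.

Theorem proposition1p3 (R : realType) (gT : finGroupType) (mu : gT -> R)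
    (hG : (2 <= #|gT|)%N) (hmu : is_prob_mass mu)
    (hirr : irreducible_chain (walk_mx mu))
    (haper : aperiodic_chain (walk_mx mu)) :
  exists2 C : R, 0 < C &
    forall alpha : R, 0 <= alpha < 1 ->
      exists2 rho : R, 0 < rho < 1 &
        forall (d : measure_display) (T : measurableType d)
          (P : probability T R) (S : nat -> T -> gT),
          srrw P mu alpha S ->
          forall n : nat, (1 <= n)%N ->
            tv_dist (rv_mass P (S n)) (@uniform_mass R gT)
              <= C * rho `^ ((1 - alpha) * n%:R).
Proof.
have [m m_gt0 [theta theta01 mu_m]] := walk_block_contracts hmu hirr haper.
(* [1 - q >= 1 / 2] will absorb the rounding of the number of blocks, which is
   why the constant depends on nothing. *)
exists 2 => // alpha alpha01.
case/andP: (theta01) => theta0 theta1; case/andP: (alpha01) => alpha0 alpha1.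
set q := (1 - alpha) ^+ m * (1 - theta) / 2.
have q_gt0 : 0 < q by rewrite !mulr_gt0 ?exprn_gt0 ?subr_gt0 ?invr_gt0.
have q_le : q <= 2^-1.
  rewrite /q -[leRHS]mul1r ler_pM2r ?invr_gt0 // -[leRHS]mulr1.
  by rewrite ler_pM ?exprn_ge0 ?exprn_ile1 //; lra.
have eta_ge0 : 0 <= theta^-1 - 1 by rewrite eta_ge0.
(* At least [D] steps precede the window for each step in it, so that a source
   is late with probability at most [D%:R^-1]. *)
set x := 2 ^+ m * (theta^-1 - 1) / q.
have x_ge0 : 0 <= x by rewrite !mulr_ge0 ?exprn_ge0 ?invr_ge0 // ltW.
pose D := Num.bound x.
have lt_xD : x < D%:R := archi_boundP x_ge0.
have D_gt0 : 0 < D%:R :> R := le_lt_trans x_ge0 lt_xD.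
have p_small : (1 + (theta^-1 - 1) * D%:R^-1) ^+ m <= 1 + q.
  have le_q : 2 ^+ m * ((theta^-1 - 1) * D%:R^-1) <= q.
    by rewrite mulrA ler_pdivrMr // [leRHS]mulrC -ler_pdivrMr // ltW.
  have pow1 : 1 <= 2 ^+ m :> R by rewrite exprn_ege1 // ler1n.
  have y_ge0 : 0 <= (theta^-1 - 1) * D%:R^-1 by rewrite mulr_ge0 ?invr_ge0 // ltW.
  apply: le_trans (expr1D_le m _) _; last by rewrite lerD2l.
  rewrite y_ge0 /=; apply: le_trans (_ : _ <= q) _; last by lra.
  by apply: le_trans le_q; rewrite ler_peMl.
(* One block per [L] steps. *)
pose L := (m * D.+1)%N.
have L_gt0 : 0 < (L%:R : R) by rewrite ltr0n muln_gt0 m_gt0.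
have alpha'0 : 0 < 1 - alpha by rewrite subr_gt0.
have r01 : 0 < 1 - q < 1 by lra.
exists ((1 - q) `^ (L%:R * (1 - alpha))^-1).
  case/andP: r01 => r0 r1.
  rewrite powR_gt0 //=.
  have e_gt0 : 0 < (L%:R * (1 - alpha))^-1 by rewrite invr_gt0 mulr_gt0.
  apply: (@lt_le_trans _ _ (1 `^ (L%:R * (1 - alpha))^-1)); last by rewrite powR1.
  by rewrite gt0_ltr_powR ?nnegrE // ltW.
move=> d T P S walk [//|n] _; set K := (n.+1 %/ L)%N.
have D_pos : (0 < D)%N by rewrite -(ltr0n R).
have [le_Km window M_gt0] := window_size n m D_pos.
apply: (@le_trans _ _ ((1 - q) ^+ K)).
  apply: (srrw_tv_le hmu theta01 mu_m alpha01 walk window M_gt0 _ p_small).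
  by rewrite mulrC ler_pdivlMr // -natrM ler_nat.
rewrite -powRrM invfM -mulrA mulKf ?gt_eqF //.
apply: (@le_trans _ _ (2 * (1 - q) ^+ K.+1)).
  rewrite exprS mulrA ler_peMl ?exprn_ge0 //; lra.
rewrite ler_pM2l // -powR_mulrn; last by lra.
apply: ger_powR; first by case/andP: r01 => -> /ltW.
rewrite ler_pdivrMl // -natrM ler_nat.
by rewrite mulnC ltnW // ltn_ceil // muln_gt0 m_gt0.
Qed.
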